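(* Let $\Gamma$ be a connected $k$-regular bipartite graph on $v$ vertices with five distinct eigenvalues. If $\Gamma$ has a full indubitable partition corresponding to an eigenvalue $\lambda\neq -k$ with multiplicity $m$, then $\lambda=-k/m$ and $\Gamma$ is (isomorphic to) the bipartite double of a complete $(m+1)$-partite graph.
   Context: Graphs are finite, simple and undirected; eigenvalues of $\Gamma$ are those of its $01$-adjacency matrix. A partition $\Pi$ of the vertex set of a connected graph $\Gamma$ (into nonempty cells) is indubitable with parameters $(a,b)$ if for each cell $\mathcal{P}\in\Pi$ and each vertex $x$, the number of neighbors of $x$ in $\mathcal{P}$ equals $a$ if $x\in\mathcal{P}$, and equals $b$ otherwise. An indubitable partition with $r+1\ge2$ cells corresponds to the eigenvalue $\lambda=a-b$ of $\Gamma$; it is full (corresponding to $\lambda$) if $r$ equals the multiplicity $m$ of $\lambda$ as an eigenvalue of $\Gamma$. The bipartite double of a graph with adjacency matrix $A$ is the graph with adjacency matrix $(J_2-I_2)\otimes A$, where $J_2$ is the $2\times2$ all-ones matrix. *)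

(* Defs.v *)
From HB Require Import structures.
From mathcomp Require Import all_boot all_order all_algebra all_field.

Set Implicit Arguments.
Unset Strict Implicit.
Unset Printing Implicit Defensive.

Import GRing.Theory Num.Theory.
Local Open Scope ring_scope.

Record sgraph := SGraph {
  vertex :> finType;
  adj : rel vertex;
  adj_sym : symmetric adj;
  adj_irr : irreflexive adj
}.

Definition nbhd (G : sgraph) (x : G) : {set G} := [set y | adj x y].

Definition regular (G : sgraph) (k : nat) : Prop :=
  forall x : G, #|nbhd x| = k.

Definition connected (G : sgraph) : Prop :=
  forall x y : G, connect (@adj G) x y.

Definition bipartite (G : sgraph) : Prop :=
  exists c : G -> bool, forall x y : G, adj x y -> c x != c y.

Definition isomorphic (G H : sgraph) : Prop :=
  exists2 f : G -> H, bijective f & forall x y : G, adj (f x) (f y) = adj x y.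

(* The adjacency matrix is integral, so all its complex eigenvalues are       *)
(* algebraic and nothing is lost by working over algC.                        *)
Definition adjmx (G : sgraph) : 'M[algC]_#|G| :=
  \matrix_(i, j) (adj (enum_val i) (enum_val j))%:R.

Definition graph_eigenvalue (G : sgraph) (lambda : algC) : Prop :=
  eigenvalue (adjmx G) lambda.

(* Dimension of the eigenspace; adjmx G is real symmetric, hence              *)
(* diagonalizable, so geometric and algebraic multiplicities agree.           *)
Definition multiplicity (G : sgraph) (lambda : algC) : nat :=
  \rank (eigenspace (adjmx G) lambda).

Definition num_distinct_eigenvalues (G : sgraph) (d : nat) : Prop :=
  exists s : seq algC,
    [/\ uniq s, size s = d & forall z, z \in s <-> graph_eigenvalue G z].

(* The finset predicate [partition] forces the cells to be nonempty. *)
Definition indubitable (G : sgraph) (P : {set {set G}}) (a b : nat) : Prop :=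
  partition P [set: G] /\
  forall (B : {set G}) (x : G), B \in P ->
    #|nbhd x :&: B| = if x \in B then a else b.

Definition indubitable_for (G : sgraph) (P : {set {set G}}) (lambda : algC) :
    Prop :=
  exists a b : nat,
    [/\ indubitable P a b, (2 <= #|P|)%N & lambda = a%:R - b%:R].

Definition full_indubitable (G : sgraph) (P : {set {set G}}) (lambda : algC) :
    Prop :=
  indubitable_for P lambda /\ #|P| = (multiplicity G lambda).+1.

Definition complete_multipartite (G : sgraph) (n : nat) : Prop :=
  exists P : {set {set G}},
    [/\ partition P [set: G], #|P| = n
      & forall x y : G, adj x y = (pblock P x != pblock P y)].

Section BipartiteDouble.
Variable G : sgraph.

(* The 01-relation of (J_2 - I_2) (x) A, indexed by bool * G. *)
Definition double_adj : rel (bool * G)%type :=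
  fun u w => (u.1 != w.1) && adj u.2 w.2.

Lemma double_adj_sym : symmetric double_adj.
Proof. by move=> u w; rewrite /double_adj eq_sym adj_sym. Qed.

Lemma double_adj_irr : irreflexive double_adj.
Proof. by move=> u; rewrite /double_adj eqxx. Qed.

Definition bipartite_double : sgraph := SGraph double_adj_sym double_adj_irr.
End BipartiteDouble.

(* Main.v *)
Require Import Defs.
From HB Require Import structures.
From mathcomp Require Import all_boot all_order all_algebra all_field.
From mathcomp Require Import spectral ring.

Set Implicit Arguments.
Unset Strict Implicit.
Unset Printing Implicit Defensive.

Import GRing.Theory Num.Theory.
Local Open Scope ring_scope.

(* Multiplying by the sign [s] of the 2-colouring exchanges the eigenspaces of
   [z] and [- z], so the spectrum is [k, -k, l, -l, 0]; here [l <> 0], since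
   otherwise the cells would be monochromatic.  Fullness says that the
   eigenfunctions of [l] are the functions of zero sum that are constant on
   cells, and those of [- l] are their products with [s].  As the eigenspaces
   of [k] and [- k] are spanned by [1] and [s], the whole adjacency matrix is
   known:
     A x y = (1 - s x * s y) / v * (k - l + l * (m + 1) * [x, y in one cell]).
   Its entries being 0 or 1, two vertices are adjacent exactly when they differ
   both in colour and in cell, and every cell then contains equally many
   vertices of each colour. *)

(** * Eigenfunctions and the spectral theorem *)

(** The zero function is allowed; non-vanishing is required separately where it matters. *)
Definition eigenfun (G : sgraph) (f : G -> algC) (d : algC) : Prop :=
  forall x, \sum_(y | adj x y) f y = d * f x.

Lemma sum_adj_sym (G : sgraph) (F : G -> G -> algC) :
  \sum_x \sum_(y | adj x y) F x y = \sum_x \sum_(y | adj x y) F y x.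
Proof.
under eq_bigr do rewrite big_mkcond.
rewrite exchange_big; apply: eq_bigr => x _ /=.
by rewrite [RHS]big_mkcond; apply: eq_bigr => y _; rewrite adj_sym.
Qed.

(** Self-adjointness of the adjacency operator for the bilinear form, without conjugation. *)
Lemma sum_adj_swap (G : sgraph) (f g : G -> algC) :
  \sum_x f x * (\sum_(y | adj x y) g y) = \sum_x g x * (\sum_(y | adj x y) f y).
Proof.
under eq_bigr do rewrite mulr_sumr.
rewrite sum_adj_sym; apply: eq_bigr => x _; rewrite mulr_sumr.
by apply: eq_bigr => y _; rewrite mulrC.
Qed.

Lemma eigenfun_pairing (G : sgraph) (f g : G -> algC) (d : algC) :
  eigenfun f d ->
  \sum_x f x * (\sum_(y | adj x y) g y) = d * \sum_x f x * g x.
Proof.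
move=> fd; rewrite sum_adj_swap mulr_sumr; apply: eq_bigr => x _.
by rewrite fd; ring.
Qed.

Lemma mul_row_adjmx (G : sgraph) (u : 'rV[algC]_#|G|) (x : G) :
  (u *m adjmx G) 0 (enum_rank x) = \sum_(y | adj x y) u 0 (enum_rank y).
Proof.
rewrite mxE [RHS]big_mkcond (reindex _ (onW_bij _ (enum_rank_bij G))) /=.
apply: eq_bigr => y _; rewrite mxE !enum_rankK adj_sym.
by case: adj; rewrite ?mulr1 ?mulr0.
Qed.

Lemma row_eigenfun (G : sgraph) (u : 'rV[algC]_#|G|) (d : algC) :
  u *m adjmx G = d *: u <-> eigenfun (fun x => u 0 (enum_rank x)) d.
Proof.
split=> [ud x | ud]; first by rewrite -mul_row_adjmx ud mxE.
apply/rowP=> i; rewrite -(enum_valK i) mul_row_adjmx.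
by rewrite (ud (enum_val i)) mxE.
Qed.

Definition fun_row (G : sgraph) (f : G -> algC) : 'rV[algC]_#|G| :=
  \row_i f (enum_val i).

Lemma fun_rowE (G : sgraph) (f : G -> algC) (x : G) :
  fun_row f 0 (enum_rank x) = f x.
Proof. by rewrite mxE enum_rankK. Qed.

Lemma eigenfun_row (G : sgraph) (f : G -> algC) (d : algC) :
  eigenfun f d -> fun_row f *m adjmx G = d *: fun_row f.
Proof.
move=> fd; apply/row_eigenfun => x; rewrite fun_rowE -fd.
by apply: eq_bigr => y _; rewrite fun_rowE.
Qed.

Lemma eigenfun_eigenvalue (G : sgraph) (f : G -> algC) (d : algC) (x : G) :
  eigenfun f d -> f x != 0 -> graph_eigenvalue G d.
Proof.
move=> fd fx0; apply/eigenvalueP; exists (fun_row f); first exact: eigenfun_row.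
by apply: contra_neq fx0 => u0; rewrite -(fun_rowE f) u0 mxE.
Qed.

Lemma eigenvalue_eigenfun (G : sgraph) (d : algC) :
  graph_eigenvalue G d ->
  exists2 f : G -> algC, eigenfun f d & exists x, f x != 0.
Proof.
case/eigenvalueP=> u ud u0; exists (fun x => u 0 (enum_rank x)).
  exact/row_eigenfun.
have [i ui0] := rV0Pn u u0.
by exists (enum_val i); rewrite enum_valK.
Qed.

Lemma adjmx_normal (G : sgraph) : adjmx G \is normalmx.
Proof.
apply: symmetric_normalmx.
  apply/is_hermitianmxP; rewrite expr0 scale1r.
  by apply/matrixP=> i j; rewrite !mxE adj_sym.
by apply/mxOverP=> i j; rewrite mxE realn.
Qed.

(* Spectral theorem: the adjacency matrix has a basis of eigenfunctions. *)
Lemma eigenfun_total (G : sgraph) (g : G -> algC) :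
  (forall f d, eigenfun f d -> (exists x, f x != 0) -> \sum_x f x * g x = 0) ->
  forall x, g x = 0.
Proof.
move=> g_orth x.
have /orthomx_spectralP := adjmx_normal G.
set Q := spectralmx _; set D := spectral_diag _ => defA.
have Qu : Q \in unitmx by exact: spectral_unit.
have QA : Q *m adjmx G = diag_mx D *m Q.
  by rewrite defA !mulmxA mulmxV // mul1mx.
(* The rows of [Q] are eigenvectors, so [g_orth] kills every entry of this product, and [Q] is
   invertible. *)
suff Qg : Q *m (fun_row g)^T = 0.
  have := congr1 (mulmx (invmx Q)) Qg; rewrite mulmxA mulVmx // mul1mx mulmx0.
  by move/matrixP/(_ (enum_rank x) 0); rewrite !mxE enum_rankK.
apply/colP=> i; rewrite mxE [RHS]mxE.
have Qi : eigenfun (fun y => row i Q 0 (enum_rank y)) (D 0 i).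
  apply/row_eigenfun; rewrite -row_mul QA mul_diag_mx.
  by apply/rowP=> j; rewrite !mxE.
rewrite -[RHS](g_orth _ _ Qi).
  rewrite (reindex _ (onW_bij _ (enum_rank_bij G))) /=.
  by apply: eq_bigr => y _; rewrite !mxE enum_rankK.
(* A zero row of [Q] would give a zero row in [Q] times its inverse. *)
have /rV0Pn[j Qj] : row i Q != 0.
  apply/eqP=> Qi0; have := congr1 (row i) (mulmxV Qu).
  rewrite row_mul Qi0 mul0mx row1 => /rowP/(_ i)/eqP.
  by rewrite !mxE !eqxx eq_sym oner_eq0.
by exists (enum_val j); rewrite enum_valK.
Qed.

(** * Regular graphs and the eigenvalue [k] *)

Section Regular.
Variables (G : sgraph) (k : nat).
Hypotheses (conn_G : connected G) (reg_G : regular G k).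

Lemma sum_adj_const (x : G) (z : algC) : \sum_(y | adj x y) z = k%:R * z.
Proof.
rewrite sumr_const mulr_natl -(reg_G x) /nbhd; congr (_ *+ _).
by apply: eq_card => y; rewrite inE.
Qed.

(* The Dirichlet energy of an eigenfunction with eigenvalue [k] vanishes. *)
Lemma eigenfun_valency_const (f : G -> algC) :
  eigenfun f k%:R -> forall x y, f x = f y.
Proof.
move=> fk.
have E0 : \sum_x \sum_(y | adj x y) `|f x - f y| ^+ 2 = 0.
  under eq_bigr => x _.
    under eq_bigr => y _ do
      rewrite normCK rmorphB mulrBl !mulrBr.
    over.
  (* Each of the four sums from the expanded square equals [k] times the sum of the squared norms of
     [f], so they cancel. *)
  have s1 : \sum_x \sum_(y | adj x y) f x * (f y)^* =
            \sum_x k%:R * (f x * (f x)^*).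
    rewrite (sum_adj_sym (fun x y => f x * (f y)^*)).
    by apply: eq_bigr => x _; rewrite -mulr_suml fk mulrA.
  have s2 : \sum_x \sum_(y | adj x y) f y * (f x)^* =
            \sum_x k%:R * (f x * (f x)^*).
    by apply: eq_bigr => x _; rewrite -mulr_suml fk mulrA.
  have s3 : \sum_x \sum_(y | adj x y) f x * (f x)^* =
            \sum_x k%:R * (f x * (f x)^*).
    by apply: eq_bigr => x _; rewrite sum_adj_const.
  have s4 : \sum_x \sum_(y | adj x y) f y * (f y)^* =
            \sum_x k%:R * (f x * (f x)^*).
    by rewrite -s3 (sum_adj_sym (fun x y => f x * (f x)^*)).
  under eq_bigr => x _ do rewrite !sumrB.
  rewrite !sumrB s1 s2 s3 s4; ring.
have step x y : adj x y -> f x = f y.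
  move=> xy; apply/eqP; rewrite -subr_eq0 -normr_eq0 -sqrf_eq0.
  have ge0 u w : 0 <= `|f u - f w| ^+ 2 by rewrite exprn_ge0.
  have Ex : \sum_(w | adj x w) `|f x - f w| ^+ 2 = 0.
    by apply: (psumr_eq0P _ E0) => // u _; apply: sumr_ge0.
  by apply/eqP; apply: (psumr_eq0P _ Ex).
move=> x y; apply/eqP.
have cl : closed (@adj G) [pred z | f x == f z].
  by move=> u w uw; rewrite !inE (step _ _ uw).
by have := closed_connect cl (conn_G x y); rewrite !inE eqxx => <-.
Qed.

End Regular.

(** * The sign of a 2-colouring and the symmetry of the spectrum *)

Section Colouring.
Variables (G : sgraph) (c : G -> bool).
Hypothesis (col_c : forall x y, adj x y -> c x != c y).

Definition sgn (x : G) : algC := (-1) ^+ c x.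

Lemma sgnK (x : G) : sgn x * sgn x = 1.
Proof. by rewrite -expr2 sqrr_sign. Qed.

Lemma sgn_neq0 (x : G) : sgn x != 0.
Proof. by rewrite signr_eq0. Qed.

Lemma sgn_opp (x y : G) : c x != c y -> sgn y = - sgn x.
Proof. by rewrite /sgn; case: (c x) (c y) => [] []; rewrite // ?opprK. Qed.

(** All neighbours of [x] carry the sign opposite to that of [x]. *)
Lemma sum_adj_sgn (f : G -> algC) (x : G) :
  \sum_(y | adj x y) sgn y * f y = - sgn x * \sum_(y | adj x y) f y.
Proof.
rewrite mulr_sumr; apply: eq_bigr => y xy.
by rewrite (sgn_opp (col_c xy)) mulNr.
Qed.

Lemma eigenfun_sgn (f : G -> algC) (d : algC) :
  eigenfun f d -> eigenfun (fun x => sgn x * f x) (- d).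
Proof. by move=> fd x; rewrite sum_adj_sgn fd; ring. Qed.

Lemma eigenvalueN (d : algC) : graph_eigenvalue G d -> graph_eigenvalue G (- d).
Proof.
case/eigenvalue_eigenfun=> f fd [x fx].
apply: (eigenfun_eigenvalue (x := x) (eigenfun_sgn fd)).
by rewrite mulf_neq0 // sgn_neq0.
Qed.

(* A sixth eigenvalue would appear together with its opposite. *)
Lemma five_eigenvalues (z1 z2 d : algC) :
  num_distinct_eigenvalues G 5 ->
  graph_eigenvalue G z1 -> graph_eigenvalue G z2 -> graph_eigenvalue G d ->
  z1 != 0 -> z2 != 0 -> z1 != z2 -> z1 != - z2 ->
  d \in [:: z1; - z1; z2; - z2; 0].
Proof.
case=> s [s_uniq s_size s_eig] e1 e2 ed z10 z20 z12 z12'.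
apply/negPn/negP => dNs.
have neqN (z : algC) : z != 0 -> (z == - z) = false.
  by move=> z0; rewrite -addr_eq0 -mulr2n mulrn_eq0 (negPf z0).
suff: (size [:: d; - d; z1; - z1; z2; - z2] <= size s)%N by rewrite s_size.
apply: uniq_leq_size.
  move: dNs; rewrite /= !inE !negb_or => /and5P[d1 d2 d3 d4 d5].
  rewrite !eqr_oppLR !opprK !neqN // !(negPf d1) !(negPf d2) !(negPf d3).
  by rewrite !(negPf d4) (negPf z12) (negPf z12').
move=> z; rewrite !inE => /or4P[/eqP->|/eqP->|/eqP->|/or3P[]/eqP->];
  apply/s_eig => //; exact: eigenvalueN.
Qed.

End Colouring.

(** * Indubitable partitions of regular graphs and their eigenfunctions *)

Section Indubitable.
Variables (G : sgraph) (k : nat) (P : {set {set G}}) (a b : nat).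
Hypotheses (conn_G : connected G) (reg_G : regular G k).
Hypotheses (indP : indubitable P a b) (P_gt1 : (2 <= #|P|)%N).

Let partP : partition P [set: G] := proj1 indP.
Let trivP : trivIset P.
Proof. by case/and3P: partP. Qed.
Let lam : algC := a%:R - b%:R.
Let n : algC := #|P|%:R.

Let n_neq0 : n != 0.
Proof. by rewrite pnatr_eq0 -lt0n; apply: leq_trans P_gt1. Qed.

Lemma cell_cover (x : G) : x \in cover P.
Proof. by rewrite (cover_partition partP) inE. Qed.

Lemma mem_cell (x : G) : x \in pblock P x.
Proof. by rewrite mem_pblock cell_cover. Qed.

Lemma cell_in (x : G) : pblock P x \in P.
Proof. by rewrite pblock_mem ?cell_cover. Qed.

Lemma in_cell (B : {set G}) (x : G) : B \in P -> (x \in B) = (pblock P x == B).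
Proof.
move=> PB; apply/idP/eqP=> [xB | <-]; last exact: mem_cell.
exact: def_pblock trivP PB xB.
Qed.

Lemma cell_nonempty (B : {set G}) : B \in P -> exists x, x \in B.
Proof.
by move=> PB; apply/set0Pn; apply: contraTneq PB => ->; case/and3P: partP.
Qed.

Lemma other_cell (x : G) : exists y, pblock P y != pblock P x.
Proof.
have : (0 < #|P :\ pblock P x|)%N.
  by move: P_gt1; rewrite (cardsD1 (pblock P x)) cell_in.
case/card_gt0P=> B; rewrite !inE => /andP[BNx PB].
have [y yB] := cell_nonempty PB.
by exists y; move: yB; rewrite in_cell // => /eqP->.
Qed.

Lemma exists_vertex : exists x : G, True.
Proof.
have /card_gt0P[B PB] : (0 < #|P|)%N by apply: leq_trans P_gt1.
by have [x _] := cell_nonempty PB; exists x.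
Qed.

Lemma sum_cell_indicator (x : G) : \sum_(B in P) (x \in B)%:R = 1 :> algC.
Proof.
rewrite (bigD1 (pblock P x)) ?cell_in //= mem_cell big1 ?addr0 //.
by move=> B /andP[PB]; rewrite in_cell // eq_sym => /negPf->.
Qed.

Lemma sum_adj_cell (B : {set G}) (x : G) : B \in P ->
  \sum_(y | adj x y) (y \in B)%:R = lam * (x \in B)%:R + b%:R :> algC.
Proof.
move=> PB; transitivity (#|nbhd x :&: B|%:R : algC).
  rewrite -sum1_card natr_sum big_mkcond [RHS]big_mkcond.
  by apply: eq_bigr => y _; rewrite !inE; do 2!case: ifP => //; case: (y \in B).
rewrite (proj2 indP) // /lam; case: (x \in B).
  by rewrite mulr1 subrK.
by rewrite mulr0 add0r.
Qed.

(** A vertex has [a] neighbours in its own cell and [b] in each of the other [n - 1], and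
    [a + (n - 1) * b = lam + n * b]. *)
Lemma valency_cells : k%:R = lam + n * b%:R :> algC.
Proof.
have [x _] := exists_vertex.
rewrite -[LHS]mulr1 -(sum_adj_const reg_G x).
under eq_bigr => y _ do rewrite -(sum_cell_indicator y).
rewrite exchange_big /=.
under eq_bigr => B PB do rewrite sum_adj_cell //.
by rewrite big_split /= -mulr_sumr sum_cell_indicator mulr1 sumr_const
  mulr_natl.
Qed.

Lemma eigenfun_const1 : eigenfun (fun _ : G => 1) k%:R.
Proof. by move=> x; rewrite (sum_adj_const reg_G). Qed.

(** The indicator of [B] is sent to [lam] times itself plus the constant [b]; the shift by [1 / n]
    absorbs this constant because [k = lam + n * b]. *)
Lemma eigenfun_cell (B : {set G}) : B \in P ->
  eigenfun (fun x => n * (x \in B)%:R - 1) lam.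
Proof.
move=> PB x; rewrite sumrB -mulr_sumr sum_adj_cell // (sum_adj_const reg_G).
by rewrite valency_cells; ring.
Qed.

(** With [b = 0] no edge would leave a cell, against connectedness and the presence of a second
    cell. *)
Lemma offdiag_neq0 : b != 0%N.
Proof.
apply/eqP=> b0; have [x _] := exists_vertex; have [y] := other_cell x.
have cl : closed (@adj G) [pred z | pblock P z == pblock P x].
  move=> u w uw; rewrite !inE; congr (_ == _); apply/eqP.
  rewrite -in_cell ?cell_in //; apply: contraT => uNw.
  have := proj2 indP _ u (cell_in w); rewrite (negPf uNw) b0 => /eqP.
  rewrite cards_eq0 => /eqP/setP/(_ w).
  by rewrite !inE uw mem_cell.
by have := closed_connect cl (conn_G x y); rewrite !inE eqxx => <-.
Qed.

Lemma valency_neq_eigenvalue : k%:R != lam.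
Proof.
rewrite valency_cells -subr_eq0 addrAC subrr add0r mulf_neq0 //.
by rewrite pnatr_eq0 offdiag_neq0.
Qed.

(** Double counting of the edges into [B] gives [lam * #|B| + #|G| * b = k * #|B|]; after inserting
    [k = lam + n * b] the factor [b] cancels. *)
Lemma card_cell (B : {set G}) : B \in P -> n * #|B|%:R = #|G|%:R :> algC.
Proof.
move=> PB; have := eigenfun_pairing (fun x => (x \in B)%:R) eigenfun_const1.
have sumB : \sum_x (x \in B)%:R = #|B|%:R :> algC.
  rewrite -sum1_card natr_sum [RHS]big_mkcond.
  by apply: eq_bigr => x _; case: ifP.
under eq_bigr do rewrite sum_adj_cell // mul1r.
under [in RHS]eq_bigr do rewrite mul1r.
rewrite sumB big_split /= -mulr_sumr sumB sumr_const valency_cells.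
have b0 : b%:R != 0 :> algC by rewrite pnatr_eq0 offdiag_neq0.
rewrite [RHS]mulrDl => E; have {}E := addrI _ E; apply: (mulIf b0).
by rewrite mulrAC -E mulr_natl.
Qed.

(* The cell indicators are independent, so fullness makes them span the sum of
   the eigenspaces of [lam] and [k]. *)
Lemma full_eigenfun_const (f : G -> algC) (x y : G) :
  #|P| = (multiplicity G lam).+1 -> eigenfun f lam ->
  pblock P x = pblock P y -> f x = f y.
Proof.
move=> fullP f_lam xy.
pose C : 'M[algC]_(#|P|, #|G|) :=
  \matrix_(i, j) (enum_val j \in (enum_val i : {set G}))%:R.
pose E := (eigenspace (adjmx G) lam + fun_row (fun _ : G => 1%R))%MS.
have sCE : (C <= E)%MS.
  apply/row_subP=> i; have PB := enum_valP i.
  have -> : row i C =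
      n^-1 *: fun_row (fun x => n * (x \in (enum_val i : {set G}))%:R - 1)
      + n^-1 *: fun_row (fun _ => 1).
    apply/rowP=> j; rewrite !mxE.
    set t := _%:R; transitivity (n^-1 * n * t); last by ring.
    by rewrite mulVf // mul1r.
  apply: addmx_sub_adds; apply: scalemx_sub => //.
  by apply/eigenspaceP/eigenfun_row/eigenfun_cell.
have rC : \rank C = #|P|.
  apply/eqP; rewrite -[_ == _]/(row_free C); apply: inj_row_free => u uC.
  (* Evaluating a vanishing combination at a vertex of cell [i] isolates the coefficient of that
     cell. *)
  apply/rowP=> i; have [z zi] := cell_nonempty (enum_valP i).
  have /rowP/(_ (enum_rank z)) := uC; rewrite !mxE => <-.
  rewrite (bigD1 i) //= !mxE enum_rankK zi mulr1 big1 ?addr0 // => j ji.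
  rewrite mxE enum_rankK; case zj: (z \in _); last by rewrite mulr0.
  case/eqP: ji; apply: enum_val_inj.
  rewrite -(def_pblock trivP (enum_valP i) zi).
  by rewrite -(def_pblock trivP (enum_valP j) zj).
(* The rank of [E] is at most the multiplicity plus one, which is [#|P|], the rank of [C]. *)
have sEC : (E <= C)%MS.
  rewrite -(mxrank_leqif_sup sCE) eqn_leq mxrankS //= rC fullP.
  apply: leq_trans (mxrank_adds_leqif _ _) _.
  by rewrite -[leqRHS]addn1 leq_add2l rank_leq_row.
have : (fun_row f <= C)%MS.
  apply: submx_trans sEC; apply: submx_trans (addsmxSl _ _).
  by apply/eigenspaceP/eigenfun_row.
case/submxP=> D fD; rewrite -(fun_rowE f x) -(fun_rowE f y) fD !mxE.
apply: eq_bigr => i _; rewrite !mxE !enum_rankK.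
by rewrite !in_cell ?enum_valP // xy.
Qed.

End Indubitable.

(** * Full partitions: the spectrum and the spectral formula for adjacency *)

Section FullPartition.
Variables (G : sgraph) (k : nat) (P : {set {set G}}) (a b : nat).
Variable c : G -> bool.
Hypotheses (conn_G : connected G) (reg_G : regular G k).
Hypothesis (col_c : forall x y, adj x y -> c x != c y).
Hypotheses (indP : indubitable P a b) (P_gt1 : (2 <= #|P|)%N).
Local Notation lam := (a%:R - b%:R : algC).
Local Notation n := (#|P|%:R : algC).
Hypotheses (fullP : #|P| = (multiplicity G lam).+1) (lamNk : lam != - k%:R).
Hypothesis five_G : num_distinct_eigenvalues G 5.

Let b_neq0 : b%:R != 0 :> algC.
Proof. by rewrite pnatr_eq0 (offdiag_neq0 conn_G indP). Qed.

Let n_neq0 : n != 0.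
Proof. by rewrite pnatr_eq0 -lt0n; apply: leq_trans P_gt1. Qed.

Let kNlam : k%:R != lam := valency_neq_eigenvalue conn_G reg_G indP P_gt1.

(* The kernel is stable under the sign of the colouring, so [lam = 0] would
   make every cell monochromatic. *)
Lemma full_eigenvalue_neq0 : lam != 0.
Proof.
apply/eqP=> lam0; have [x _] := exists_vertex indP P_gt1.
have PB := cell_in indP x.
have ef := eigenfun_cell reg_G indP P_gt1 PB.
have efs : eigenfun (fun z => sgn c z * (n * (z \in pblock P x)%:R - 1)) lam.
  by have := eigenfun_sgn col_c ef; rewrite lam0 oppr0.
suff : a = 0%N.
  move=> a0; move/eqP: lam0; rewrite a0 sub0r oppr_eq0.
  by rewrite (negPf b_neq0).
have := proj2 indP _ x PB; rewrite (mem_cell indP) => <-.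
apply/eqP; rewrite cards_eq0 -subset0; apply/subsetP=> y.
rewrite !inE => /andP[xy yB]; have yE : pblock P y = pblock P x.
  by apply/eqP; rewrite -(in_cell indP).
(* At the adjacent vertices [x] and [y] of one cell the signed function takes opposite values of
   modulus [n - 1]; equal values would force [n = 1]. *)
have := full_eigenfun_const reg_G indP P_gt1 fullP efs yE.
rewrite yB (mem_cell indP) (sgn_opp (col_c xy)) mulr1 => /eqP.
rewrite mulNr eq_sym -addr_eq0 -mulr2n mulrn_eq0 /= mulf_eq0.
rewrite (negPf (sgn_neq0 _ _)).
rewrite subr_eq0 pnatr_eq1 /= => /eqP n1.
by move: P_gt1; rewrite n1.
Qed.

Let lam_neq0 := full_eigenvalue_neq0.

Let k_neq0 : k%:R != 0 :> algC.
Proof.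
rewrite pnatr_eq0; apply/eqP=> k0; have [x _] := exists_vertex indP P_gt1.
have [y yNx] := other_cell indP P_gt1 x.
have := proj2 indP _ x (cell_in indP y).
rewrite (in_cell indP) ?(cell_in indP) // eq_sym (negPf yNx) => nxy.
have : (#|nbhd x :&: pblock P y| <= #|nbhd x|)%N.
  by rewrite subset_leq_card ?subsetIl.
by rewrite nxy reg_G k0 leqn0 -(pnatr_eq0 algC) (negPf b_neq0).
Qed.

(** The values [k], [lam] and their opposites are nonzero and pairwise distinct: [k - lam = n * b],
    and [lam] differs from [- k] by hypothesis. *)
Lemma eigenvalue_cases (d : algC) : graph_eigenvalue G d ->
  d \in [:: k%:R; - k%:R; lam; - lam; 0].
Proof.
move=> ed; have [x _] := exists_vertex indP P_gt1.
have [y yNx] := other_cell indP P_gt1 x.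
apply: (five_eigenvalues col_c) => //.
- apply: (eigenfun_eigenvalue (x := x) (eigenfun_const1 reg_G)).
  by rewrite oner_eq0.
- apply: (eigenfun_eigenvalue (x := y)
            (eigenfun_cell reg_G indP P_gt1 (cell_in indP x))).
  rewrite (in_cell indP) ?(cell_in indP) // (negPf yNx) mulr0 sub0r.
  by rewrite oppr_eq0 oner_eq0.
by rewrite -eqr_oppLR eq_sym.
Qed.

(* The right-hand side is the spectral decomposition of the adjacency matrix:
   the eigenspaces of [k], [-k], [lam] and [-lam] are spanned by the constants
   and the cell indicators, up to the sign of the colouring. *)
Lemma adj_spectral (x y : G) :
  (adj x y)%:R = (1 - sgn c x * sgn c y) / #|G|%:R
                 * (k%:R - lam + lam * n * (pblock P x == pblock P y)%:R).
Proof.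
have v_neq0 : #|G|%:R != 0 :> algC.
  by rewrite pnatr_eq0 -lt0n; apply/card_gt0P; exists x.
apply/eqP; rewrite -subr_eq0; apply/eqP.
(* For fixed [y] this is a column of the difference of the two sides; it vanishes once its pairing
   with every eigenfunction is zero. *)
pose g x := (adj x y)%:R - (1 - sgn c x * sgn c y) / #|G|%:R
                 * (k%:R - lam + lam * n * (pblock P x == pblock P y)%:R).
rewrite -/(g x); apply: (eigenfun_total (g := g)) => f d fd fN0 {x}.
have /eigenvalue_cases : graph_eigenvalue G d.
  by case: fN0 => x; apply: eigenfun_eigenvalue.
set B := pblock P y; have PB : B \in P by exact: cell_in indP _.
pose S := \sum_x f x; pose T := \sum_x f x * sgn c x.
pose SB := \sum_x f x * (x \in B)%:R.
pose TB := \sum_x f x * (sgn c x * (x \in B)%:R).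
have -> : \sum_x f x * g x = d * f y
    - ((k%:R - lam) * (S - sgn c y * T) + lam * n * (SB - sgn c y * TB))
      / #|G|%:R.
  rewrite -fd [X in _ = X - _]big_mkcond /=.
  have -> : (k%:R - lam) * (S - sgn c y * T) + lam * n * (SB - sgn c y * TB) =
     \sum_x f x * ((1 - sgn c x * sgn c y)
                 * (k%:R - lam + lam * n * (x \in B)%:R)).
    rewrite !mulrBr !mulrA /S /T /SB /TB !mulr_sumr -!sumrB -big_split /=.
    by apply: eq_bigr => x _; ring.
  rewrite mulr_suml -sumrB; apply: eq_bigr => x _.
  rewrite /g adj_sym -(in_cell indP) //.
  by case: (adj y x); rewrite /=; ring.
(* Pairing [f] with [1], the sign, the indicator of [B] and the product of the last two gives four
   linear relations between these sums, by self-adjointness. *)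
have dS : d * S = k%:R * S.
  have := eigenfun_pairing (fun _ => 1) fd.
  under eq_bigr do rewrite (eigenfun_const1 reg_G) mulr1 mulrC.
  by rewrite -mulr_sumr => ->; congr (_ * _); apply: eq_bigr => x _;
    rewrite mulr1.
have dT : d * T = - k%:R * T.
  have := eigenfun_pairing (sgn c) fd.
  have es x : \sum_(y | adj x y) sgn c y = - k%:R * sgn c x.
    have := eigenfun_sgn col_c (eigenfun_const1 reg_G) x.
    by under eq_bigr do rewrite mulr1; rewrite mulr1.
  by under eq_bigr do rewrite es mulrCA; rewrite -mulr_sumr => ->.
have dSB : d * SB = lam * SB + b%:R * S.
  have := eigenfun_pairing (fun x => (x \in B)%:R) fd.
  rewrite -/SB => <-; rewrite /SB /S !mulr_sumr -big_split /=.
  by apply: eq_bigr => x _; rewrite (sum_adj_cell indP _ PB); ring.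
have dTB : d * TB = - (lam * TB + b%:R * T).
  have := eigenfun_pairing (fun x => sgn c x * (x \in B)%:R) fd.
  rewrite -/TB => <-; rewrite /TB /T !mulr_sumr -big_split -sumrN /=.
  apply: eq_bigr => x _.
  by rewrite (sum_adj_sgn col_c) (sum_adj_cell indP _ PB); ring.
have v_cell : n * #|B|%:R = #|G|%:R := card_cell conn_G reg_G indP P_gt1 PB.
have k_cells := valency_cells reg_G indP P_gt1.
have sumB (h : G -> algC) z : (forall x, x \in B -> h x = z) ->
    \sum_x h x * (x \in B)%:R = #|B|%:R * z.
  move=> hz; rewrite -sum1_card natr_sum mulr_suml [RHS]big_mkcond.
  by apply: eq_bigr => x _; case: ifP => [/hz->|];
    rewrite ?mulr0 // mulr1 mul1r.
have TBE : TB = \sum_x (sgn c x * f x) * (x \in B)%:R.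
  by apply: eq_bigr => x _; ring.
have eq0 u w t : u != w -> u * t = w * t -> t = 0 :> algC.
  move=> uw /eqP; rewrite -subr_eq0 -mulrBl mulf_eq0 subr_eq0 (negPf uw).
  by move/eqP.
have neqN z : z != 0 -> z != - z :> algC.
  by move=> z0; rewrite -addr_eq0 -mulr2n mulrn_eq0.
have sgnKM t u : sgn c y * (t * (sgn c y * u)) = t * u.
  by rewrite mulrCA [sgn c y * (_ * u)]mulrA sgnK mul1r.
have cardB z : lam * n * (#|B|%:R * z) = lam * #|G|%:R * z.
  by rewrite -v_cell; ring.
have constB h : eigenfun h lam -> forall x, x \in B -> h x = h y.
  move=> eh x; rewrite (in_cell indP) // => /eqP xB.
  exact: (full_eigenfun_const reg_G indP P_gt1 fullP eh xB).
(* In each case the relations kill all sums not belonging to [d]. The others are evaluated through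
   [f], or its product with the sign, being constant on the graph or on [B]; for [d = 0] none is
   left. *)
rewrite !inE => /or4P[/eqP dE|/eqP dE|/eqP dE|/orP[]/eqP dE];
  rewrite {}dE in fd dS dT dSB dTB *.
- have fc := eigenfun_valency_const conn_G reg_G fd.
  have T0 : T = 0 by apply: eq0 dT; exact: neqN.
  have TB0 : TB = 0.
    apply: (eq0 k%:R (- lam)); first by rewrite -eqr_oppLR eq_sym.
    by rewrite dTB T0; ring.
  have -> : S = #|G|%:R * f y.
    by rewrite /S (eq_bigr (fun _ => f y)) // sumr_const mulr_natl.
  have -> : SB = #|B|%:R * f y by apply: sumB => x _; apply: fc.
  by rewrite T0 TB0 !mulr0 !subr0 cardB; field.
- have := eigenfun_sgn col_c fd; rewrite opprK => fsd.
  have fc := eigenfun_valency_const conn_G reg_G fsd.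
  have S0 : S = 0 by apply: eq0 dS; rewrite eq_sym; exact: neqN.
  have SB0 : SB = 0.
    apply: (eq0 (- k%:R) lam); first by rewrite eq_sym.
    by rewrite dSB S0; ring.
  have -> : T = #|G|%:R * (sgn c y * f y).
    rewrite /T (eq_bigr (fun _ => sgn c y * f y)) => [|x _].
      by rewrite sumr_const mulr_natl.
    by rewrite mulrC; apply: fc.
  have -> : TB = #|B|%:R * (sgn c y * f y).
    by rewrite TBE; apply: sumB => x _; apply: fc.
  by rewrite S0 SB0 !sgnKM !sub0r !mulrN cardB; field.
- have S0 : S = 0 by apply: eq0 dS; rewrite eq_sym.
  have T0 : T = 0 by apply: eq0 dT.
  have TB0 : TB = 0.
    by apply: (eq0 lam (- lam)); [exact: neqN | rewrite dTB T0; ring].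
  have -> : SB = #|B|%:R * f y by apply: sumB; apply: constB.
  by rewrite S0 T0 TB0 !mulr0 !subr0 cardB; field.
- have := eigenfun_sgn col_c fd; rewrite opprK => fsd.
  have S0 : S = 0 by apply: eq0 dS; rewrite eqr_oppLR.
  have T0 : T = 0 by apply: eq0 dT; rewrite eqr_opp eq_sym.
  have SB0 : SB = 0.
    by apply: (eq0 (- lam) lam); [rewrite eq_sym neqN | rewrite dSB S0; ring].
  have -> : TB = #|B|%:R * (sgn c y * f y).
    by rewrite TBE; apply: sumB; apply: constB fsd.
  by rewrite S0 T0 SB0 !sgnKM !sub0r !mulrN cardB; field.
have S0 : S = 0 by apply: eq0 dS; rewrite eq_sym.
have T0 : T = 0 by apply: eq0 dT; rewrite eq_sym oppr_eq0.
have SB0 : SB = 0.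
  by apply: (eq0 lam 0) => //; move: dSB; rewrite S0 mulr0 addr0 => <-.
have TB0 : TB = 0.
  apply: (eq0 lam 0) => //; move/eqP: dTB; rewrite T0 mulr0 addr0 mul0r eq_sym.
  by rewrite oppr_eq0 => /eqP.
by rewrite S0 T0 SB0 TB0; ring.
Qed.

(** * Order, adjacency and valency read off from the spectral formula *)

Lemma neighbour_in_cell (x y : G) : pblock P x != pblock P y ->
  exists2 z, adj x z & pblock P z = pblock P y.
Proof.
move=> xNy; have := proj2 indP _ x (cell_in indP y).
rewrite (in_cell indP) ?(cell_in indP) // (negPf xNy) => nxy.
have /card_gt0P[z] : (0 < #|nbhd x :&: pblock P y|)%N.
  by rewrite nxy lt0n -(pnatr_eq0 algC).
rewrite !inE (in_cell indP) ?(cell_in indP) // => /andP[xz /eqP zy].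
by exists z.
Qed.

Let adj_spectral_opp (x y : G) : c x != c y ->
  (adj x y)%:R * #|G|%:R
  = 2%:R * (k%:R - lam + lam * n * (pblock P x == pblock P y)%:R).
Proof.
move=> cxy; have v_neq0 : #|G|%:R != 0 :> algC.
  by rewrite pnatr_eq0 -lt0n; apply/card_gt0P; exists x.
rewrite adj_spectral (sgn_opp cxy) mulrN sgnK; set t := k%:R - _ + _.
by field.
Qed.

(** At an edge between two different cells the formula reads [#|G| = 2 * (k - lam)], and
    [k - lam = n * b]. *)
Lemma card_vertices : #|G| = (2 * (#|P| * b))%N.
Proof.
have [x _] := exists_vertex indP P_gt1; have [y] := other_cell indP P_gt1 x.
rewrite eq_sym => xNy; have [z xz zy] := neighbour_in_cell xNy.
have := adj_spectral_opp (col_c xz).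
rewrite xz zy (negPf xNy) mul1r mulr0 addr0 (valency_cells reg_G indP P_gt1).
rewrite addrAC subrr add0r -!natrM => /eqP; rewrite eqr_nat.
by move/eqP.
Qed.

(** For opposite colours, an edge inside a cell would force [lam * n = 0], and a non-edge between
    different cells would force [n * b = 0]. *)
Lemma adj_cells (x y : G) :
  adj x y = (c x != c y) && (pblock P x != pblock P y).
Proof.
have [cxy | cxy] /= := boolP (c x != c y); last first.
  by apply: contraNF cxy => /col_c.
have := adj_spectral_opp cxy; rewrite card_vertices !natrM.
have -> : k%:R - lam = n * b%:R.
  by rewrite (valency_cells reg_G indP P_gt1) addrAC subrr add0r.
have two0 : 2%:R != 0 :> algC by rewrite pnatr_eq0.
case: adj; case: eqP => //= _; rewrite ?mul1r ?mul0r ?mulr1 ?mulr0 ?addr0.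
  move/(mulfI two0)/eqP; rewrite -subr_eq0 opprD addNKr oppr_eq0 mulf_eq0.
  by rewrite (negPf lam_neq0) (negPf n_neq0).
by move/esym/eqP; rewrite !mulf_eq0 (negPf two0) (negPf n_neq0) (negPf b_neq0).
Qed.

Lemma diag_eq0 : a = 0%N.
Proof.
have [x _] := exists_vertex indP P_gt1.
have := proj2 indP _ x (cell_in indP x); rewrite (mem_cell indP) => <-.
apply/eqP; rewrite cards_eq0 -subset0; apply/subsetP=> y.
rewrite !inE adj_cells (in_cell indP) ?(cell_in indP) //.
by rewrite [pblock P x == _]eq_sym; case: (pblock P y == _); rewrite ?andbF.
Qed.

Lemma valency_eq : k%:R = (n - 1) * b%:R :> algC.
Proof. by rewrite (valency_cells reg_G indP P_gt1) diag_eq0; ring. Qed.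

(** Since [a = 0], [lam = - b]; moreover [k = (n - 1) * b], where [n - 1] is the multiplicity. *)
Lemma full_eigenvalue_eq : lam = - (k%:R / (multiplicity G lam)%:R).
Proof.
have m0 : (multiplicity G lam)%:R != 0 :> algC.
  by rewrite pnatr_eq0 -lt0n -ltnS -fullP.
rewrite {1}diag_eq0 valency_eq.
have -> : n - 1 = (multiplicity G lam)%:R by rewrite fullP -natr1 addrK.
by rewrite mulrAC divff // mul1r sub0r.
Qed.

(* With only two cells, [lam = - b = - k]. *)
Lemma cells_gt2 : (2 < #|P|)%N.
Proof.
rewrite ltn_neqAle P_gt1 andbT; apply: contraNneq lamNk => P2.
by rewrite valency_eq {1}diag_eq0 -P2; apply/eqP; ring.
Qed.

(** A vertex outside [B] of the wrong colour has a neighbour in a third cell, and that neighbour has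
    the right colour. *)
Lemma outside_colour (B : {set G}) (d : bool) : B \in P ->
  exists2 x, pblock P x != B & c x = d.
Proof.
move=> PB; have [y yB] := cell_nonempty indP PB.
have [x] := other_cell indP P_gt1 y.
have -> : pblock P y = B by apply/eqP; rewrite -(in_cell indP).
move=> xNB; have [cx | cx] := eqVneq (c x) d; first by exists x.
have /card_gt0P[C] : (0 < #|P :\ B :\ pblock P x|)%N.
  have := cells_gt2; rewrite (cardsD1 B) PB (cardsD1 (pblock P x)).
  by rewrite !inE xNB (cell_in indP).
rewrite !inE => /and3P[CNx CNB PC]; have [w wC] := cell_nonempty indP PC.
have wE : pblock P w = C by apply/eqP; rewrite -(in_cell indP).
have xNw : pblock P x != pblock P w by rewrite wE eq_sym.
have [z xz zw] := neighbour_in_cell xNw.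
exists z; first by rewrite zw wE.
by have := col_c xz; case: (c x) (c z) d cx => [] [] [].
Qed.

(** * Coordinates of a vertex: its cell and its position in a colour class of the cell *)

Definition colour_cell (x : G) : {set G} :=
  [set y in pblock P x | c y == c x].

(** For a vertex [u] outside the cell, of colour opposite to [x], the [b] neighbours of [u] in the
    cell are exactly this set. *)
Lemma card_colour_cell (x : G) : #|colour_cell x| = b.
Proof.
have PB := cell_in indP x; have [u uNx cu] := outside_colour (~~ c x) PB.
have := proj2 indP _ u PB; rewrite (in_cell indP) // (negPf uNx) => <-.
apply: eq_card => y; rewrite !inE adj_cells !(in_cell indP) // cu [RHS]andbC.
case: eqP => //= ->; rewrite uNx andbT.
by case: (c x) (c y) => [] [].
Qed.

Lemma mem_colour_cell (x : G) : x \in colour_cell x.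
Proof. by rewrite inE (mem_cell indP) eqxx. Qed.

Lemma cell_index_proof (x : G) : (index (pblock P x) (enum P) < #|P|)%N.
Proof. by rewrite cardE index_mem mem_enum (cell_in indP). Qed.

Lemma colour_index_proof (x : G) :
  (index x (enum (colour_cell x)) < b)%N.
Proof.
by rewrite -(card_colour_cell x) cardE index_mem mem_enum mem_colour_cell.
Qed.

Definition cell_index (x : G) : 'I_#|P| := Ordinal (cell_index_proof x).
(** The position in an arbitrary enumeration suffices, as adjacency depends only on colour and cell;
    the two colour classes of a cell may be matched at will. *)
Definition colour_index (x : G) : 'I_b := Ordinal (colour_index_proof x).

Lemma cell_index_eq (x y : G) :
  (cell_index x == cell_index y) = (pblock P x == pblock P y).
Proof.
apply/eqP/eqP=> [/(congr1 val) /= xy | xy]; last first.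
  by apply: val_inj; rewrite /= xy.
have mP z : pblock P z \in enum P by rewrite mem_enum (cell_in indP).
by rewrite -(nth_index set0 (mP x)) xy nth_index.
Qed.

Lemma colour_index_inj (x y : G) : c x = c y -> pblock P x = pblock P y ->
  colour_index x = colour_index y -> x = y.
Proof.
move=> cxy pxy /(congr1 val) /=.
have E : colour_cell x = colour_cell y by rewrite /colour_cell cxy pxy.
have mE z : z \in enum (colour_cell z) by rewrite mem_enum mem_colour_cell.
move=> ixy; rewrite -(nth_index x (mE x)) ixy E.
by rewrite nth_index // mE.
Qed.

End FullPartition.

(** * The model: a complete multipartite graph with [n] parts of size [b] *)

Section Multipartite.
Variables n b : nat.

Definition multipartite_adj : rel ('I_n * 'I_b)%type :=
  fun u w => u.1 != w.1.

Lemma multipartite_adj_sym : symmetric multipartite_adj.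
Proof. by move=> u w; rewrite /multipartite_adj eq_sym. Qed.

Lemma multipartite_adj_irr : irreflexive multipartite_adj.
Proof. by move=> u; rewrite /multipartite_adj eqxx. Qed.

Definition multipartite : sgraph :=
  SGraph multipartite_adj_sym multipartite_adj_irr.

Lemma complete_multipartite_multipartite :
  (0 < b)%N -> complete_multipartite multipartite n.
Proof.
(* The index [o] supplies a vertex in each part, so parts are nonempty and distinct. *)
move=> b_gt0; pose o := Ordinal b_gt0.
pose part (i : 'I_n) : {set multipartite} := [set u | u.1 == i].
pose Q := [set part i | i in setT].
have part_inj : injective part.
  move=> i j /setP/(_ (i, o)); rewrite !inE eqxx.
  by move/esym/eqP.
have trivQ : trivIset Q.
  apply/trivIsetP=> _ _ /imsetP[i _ ->] /imsetP[j _ ->] ij.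
  rewrite -setI_eq0; apply/eqP/setP=> u; rewrite !inE.
  by apply: contraNF ij => /andP[/eqP<- /eqP<-].
have pblockE u : pblock Q u = part u.1.
  by apply: def_pblock; rewrite ?imset_f // inE.
exists Q; split.
- apply/and3P; split=> //.
    apply/eqP/setP=> u; rewrite inE; apply/bigcupP; exists (part u.1).
      exact: imset_f.
    by rewrite inE.
  apply/imsetP=> -[i _ /setP/(_ (i, o))].
  by rewrite !inE eqxx.
- by rewrite card_imset // cardsT card_ord.
by move=> x y; rewrite !pblockE (inj_eq part_inj).
Qed.

End Multipartite.

(** * The eigenvalue and the isomorphism with the bipartite double *)

Theorem theorem5p5 (G : sgraph) (v k m : nat) (lambda : algC)
  (card_G : #|G| = v)
  (conn_G : connected G)
  (reg_G : regular G k)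
  (bip_G : bipartite G)
  (five_G : num_distinct_eigenvalues G 5)
  (eig_lambda : graph_eigenvalue G lambda)
  (lambda_neq : lambda <> - k%:R)
  (mult_lambda : multiplicity G lambda = m)
  (full_G : exists P : {set {set G}}, full_indubitable P lambda) :
  lambda = - (k%:R / m%:R) /\
  exists2 H : sgraph,
    complete_multipartite H m.+1 & isomorphic G (bipartite_double H).
Proof.
case: full_G => P [[a [b [indP P_gt1 lamE]]] fullP].
case: bip_G => c col_c; subst lambda m.
have lamNk : a%:R - b%:R != - k%:R :> algC by apply/eqP.
split.
  exact: full_eigenvalue_eq conn_G reg_G col_c indP P_gt1 fullP lamNk five_G.
have cadj := adj_cells conn_G reg_G col_c indP P_gt1 fullP lamNk five_G.
pose ci := cell_index indP.
pose di := colour_index conn_G reg_G col_c indP P_gt1 fullP lamNk five_G.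
exists (multipartite #|P| b).
  rewrite -fullP; apply: complete_multipartite_multipartite.
  by rewrite lt0n (offdiag_neq0 conn_G indP).
(* Injectivity is enough for a bijection, since both sides have [2 * (#|P| * b)] vertices. *)
exists (fun x => (c x, (ci x, di x))).
  apply: inj_card_bij => [x y xy | ].
    have cxy : c x = c y := congr1 fst xy.
    have dxy : di x = di y := congr1 (fun u => u.2.2) xy.
    apply: (colour_index_inj cxy _ dxy); apply/eqP.
    rewrite -(cell_index_eq indP); apply/eqP.
    exact: (congr1 (fun u => u.2.1) xy).
  rewrite !card_prod !card_ord card_bool.
  by rewrite (card_vertices conn_G reg_G col_c indP P_gt1 fullP lamNk five_G).
by move=> x y; rewrite cadj -(cell_index_eq indP).
Qed.
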